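(* Let $q$ be an odd prime power, $d\ge2$ an integer, and let $P\subset\mathbb{F}_q^{2d}$. There exists $E\subset O(d)$ such that for every $g\in O(d)\setminus E$ one has $|S_g(P)|\gg q^d$. In particular, there exists an absolute positive constant $C_1$ such that $|E|\le C_1\frac{q^{d+1}|O(d)|}{|P|}$ for all $d\ge 2$. Moreover, if $d=2$, $q\equiv 3\bmod 4$ is a prime, and $P=A\times B$ with $A,B\subset\mathbb{F}_q^2$ and $|A|=|B|\ge q$, then there exists an absolute positive constant $C_2\in(0,1)$ such that $|E|\le (1-C_2)|O(2)|$.
   Context: $\mathbb{F}_q$ is the finite field with $q$ elements. $O(d)$ is the group of $d\times d$ orthogonal matrices over $\mathbb{F}_q$ (those preserving $\|x\|=x_1^2+\cdots+x_d^2$). For $P\subset\mathbb{F}_q^{2d}=\mathbb{F}_q^d\times\mathbb{F}_q^d$ and $g\in O(d)$, $S_g(P)=\{x-gy:(x,y)\in P\}\subset\mathbb{F}_q^d$. $X\gg Y$ means $Y\le CX$ for an absolute constant $C>0$; implicit constants may depend on $d$ but not on $q$, $P$, $g$. The set $E$ depends on $P$. *)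

(* Defs.v *)
From HB Require Import structures.
From mathcomp Require Import all_boot all_order all_algebra.
From mathcomp Require Import reals.

Set Implicit Arguments.
Unset Strict Implicit.
Unset Printing Implicit Defensive.

Import Order.TTheory GRing.Theory Num.Theory.
Local Open Scope ring_scope.

(* Not a norm in the analytic sense: it takes values in F and may vanish at
   nonzero vectors. *)
Definition sqnorm (F : finFieldType) (d : nat) (x : 'cV[F]_d) : F :=
  \sum_(i < d) x i 0 ^+ 2.

(* In odd characteristic these matrices are automatically invertible
   (polarization gives g^T *m g = 1%:M). *)
Definition orthogonal_group (F : finFieldType) (d : nat) : {set 'M[F]_d} :=
  [set g : 'M[F]_d | [forall x : 'cV[F]_d, sqnorm (g *m x) == sqnorm x]].

Definition rotated_diff (F : finFieldType) (d : nat) (g : 'M[F]_d)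
    (P : {set 'cV[F]_d * 'cV[F]_d}) : {set 'cV[F]_d} :=
  [set p.1 - g *m p.2 | p in P].

(* Main.v *)
Require Import Defs.
From HB Require Import structures.
From mathcomp Require Import all_boot all_order all_algebra.
From mathcomp Require Import reals.
From mathcomp Require Import finfield mpoly.
From mathcomp Require Import ring lra zify.

Set Implicit Arguments.
Unset Strict Implicit.
Unset Printing Implicit Defensive.

Import Order.TTheory GRing.Theory Num.Theory.
Local Open Scope ring_scope.

(** Write S_g for the set of differences x - g y.  The exceptional set is the
    set of all g with |S_g| < q^d / K for a constant K that grows with d; what
    has to be shown is that it is small.

    First bound.  By Cauchy-Schwarz |P|^2 <= |S_g| E_g, where E_g is the number
    of pairs of elements of P with the same difference x - g y, so an
    exceptional g has E_g q^d >= K |P|^2.  On the other hand E_g q^d - |P|^2 is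
    nonnegative and its sum over O(d) is O_d(|O(d)| q^(d+1) |P|).  This is a
    Plancherel argument.  Instead of the characters t -> psi(t (m . z)) one uses
    the whole line they span at once: the excess at a frequency m is q times the
    number of pairs with the same value of m . z, minus |P|^2.  The excess is a
    nonnegative integer, and its sum over all m counts the coincidences of z
    ([sum_excess]).  The excess of x - g y at m is the excess of the pair (x, y)
    at (m, - g^T m); when g varies with m fixed, a value g^T m = w is taken at
    most O_d(|O(d)| / q^(d-1)) times, because reflections already move m to
    about q^(d-1) places ([card_orthogonal_sending_le]).  So the average over g
    is controlled by the sum over all frequencies in F^(2d)
    ([sum_rotation_energy], [card_exceptional_le]).  The constant C_d lost here
    is absorbed in K, which is why C_1 = 1 is possible in all dimensions.

    Second bound.  Let d = 2, q = 3 mod 4 prime, J the rotation by a right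
    angle, and g_y = (1 + y J)(1 - y J)^-1 the Cayley transform.  Then
    (1 - y J)(a - g_y b) = (a - b) - y J (a + b): for fixed (a, b) this is a
    line in F^3 with height y, and the slice at height y of the union of the
    lines of A x B is the image of S_(g_y) under 1 - y J.  So a positive
    proportion of the g_y is good as soon as the union of the lines has at
    least c q^3 points.  That is a case of Bourgain's incidence conjecture,
    proved by the polynomial method of Guth and Katz.  After replacing A and B
    by subsets of q/4 elements, suppose that the union is small.  Then

    - pruning leaves a nonempty set of lines, each with more than q/2 points
      that lie on three lines ([exists_rich_sublines]);

    - some nonzero polynomial H of degree D <= q/4 vanishes on all these lines
      ([exists_vanishing_mpoly]);

    - along a line, at a point on three lines, either the gradient of H
      vanishes or the three lines lie in the tangent plane; in both cases the
      Wronskian of the two horizontal partial derivatives vanishes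
      ([rich_wronskian]).  Its degree is below q/2, so it is zero, and as the
      degrees are below the characteristic the two derivatives are proportional
      with a constant ratio ([wronskian_eq0_proportional]): the tangent plane is
      constant along the line;

    - if the gradient is not identically zero on the line, this plane contains
      a further line through each of more than q/2 - D of its points.  Two lines
      with the same a are never coplanar, since -1 is not a square; so there are
      at most q/4 lines in the plane, a contradiction ([restr_partials_eq0]);

    - hence all partial derivatives of H vanish on the lines, and induction on
      the degree gives H = 0 ([vanishing_on_rich_lines_eq0]).

    Since |O(2)| <= 4 q, the good g_y are a positive proportion of O(2). *)

(** * Finite sets and finite fields *)

Lemma leq_card_fibers (T U : finType) (X : {set T}) (Y : {set U}) (f : T -> U) k :
    (forall x, x \in X -> f x \in Y) ->
    (forall y, y \in Y -> (#|[set x in X | f x == y]| <= k)%N) ->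
  (#|X| <= k * #|Y|)%N.
Proof.
move=> fXY fib; rewrite -sum1_card (partition_big f (mem Y)) //= mulnC -sum_nat_const.
apply: leq_sum => y yY; rewrite sum1dep_card; apply: leq_trans (fib y yY).
by rewrite subset_leq_card //; apply/subsetP => x; rewrite !inE.
Qed.

Definition collisions (T : finType) (U : eqType) (f : T -> U) (S : {set T}) : nat :=
  #|[set p in setX S S | f p.1 == f p.2]|.

Lemma collisions_sum (T : finType) (U : eqType) (f : T -> U) (S : {set T}) :
  collisions f S = (\sum_(p in setX S S) (f p.1 == f p.2))%N.
Proof.
rewrite /collisions -sum1_card big_mkcond [RHS]big_mkcond; apply: eq_bigr => p _.
by rewrite in_set; case: (p \in _); case: (_ == _).
Qed.

(** Cauchy-Schwarz for the sizes of the fibres of f. *)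
Lemma sqr_card_le_collisions (T U : finType) (f : T -> U) (S : {set T}) :
  (#|S| ^ 2 <= #|f @: S| * collisions f S)%N.
Proof.
pose n (u : U) := #|[set x in S | f x == u]|.
have SE : #|S| = (\sum_(u in f @: S) n u)%N.
  rewrite -sum1_card (partition_big_imset f); apply: eq_bigr => u _.
  by rewrite sum1dep_card; apply: eq_card => x; rewrite !inE.
have cE : collisions f S = (\sum_(u in f @: S) n u ^ 2)%N.
  rewrite /collisions -sum1_card (partition_big (f \o fst) (mem (f @: S))) /=; last first.
    by move=> p; rewrite !inE => /andP[/andP[p1 _] _]; apply: imset_f.
  apply: eq_bigr => u _; rewrite sum1dep_card expnS expn1 -cardsX; apply: eq_card => p.
  rewrite !inE; case: (p.1 \in S); case: (p.2 \in S); rewrite ?andbF //=.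
  by case: (eqVneq (f p.1) u) => [->|]; rewrite ?andbT ?andbF // eq_sym.
rewrite {1}SE cE expnS expn1 big_distrlr /=.
have le2 u v : (2 * (n u * n v) <= n u ^ 2 + n v ^ 2)%N by rewrite nat_Cauchy.
rewrite -(leq_pmul2l (isT : 0 < 2)%N) big_distrr /=.
under eq_bigr do rewrite big_distrr /=.
apply: (@leq_trans (\sum_(u in f @: S) \sum_(v in f @: S) (n u ^ 2 + n v ^ 2))).
  by apply: leq_sum => u _; apply: leq_sum => v _.
under eq_bigr do rewrite big_split sum_nat_const /=.
by rewrite big_split /= sum_nat_const -big_distrr /= mul2n addnn.
Qed.

Lemma collisions_inj (T : finType) (U : eqType) (f : T -> U) (S : {set T}) :
  injective f -> collisions f S = #|S|.
Proof.
move=> fI; rewrite collisions_sum (eq_bigl (fun p => (p.1 \in S) && (p.2 \in S))); last first.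
  by move=> p; rewrite !inE.
rewrite -(pair_big_dep (mem S) (fun _ => mem S) (fun x y => (f x == f y) : nat)) /=.
rewrite -sum1_card; apply: eq_bigr => x xS; rewrite (bigD1 x) //= eqxx big1 // => y.
by rewrite eq_sym (inj_eq fI) => /andP[_ /negPf ->].
Qed.

Lemma exists_subset_card (T : finType) (A : {set T}) n :
  (n <= #|A|)%N -> exists2 B : {set T}, B \subset A & #|B| = n.
Proof.
move/card_geqP => [s [us <- sA]]; exists [set x in s].
  by apply/subsetP => x; rewrite inE => /sA.
by rewrite cardsE; apply/card_uniqP.
Qed.

(** Translation by 1 permutes F, so the sum of all elements does not change when
    1 is added to each of them. *)
Lemma card_natr_eq0 (F : finFieldType) : #|F|%:R = 0 :> F.
Proof.
have : \sum_(x : F) x = \sum_(x : F) (x + 1) by exact: reindex_inj (addIr 1).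
rewrite big_split sumr_const /= -[X in X = _]addr0 => /addrI h.
by rewrite [RHS]h.
Qed.

Lemma two_neq0 (F : finFieldType) : odd #|F| -> 2%:R != 0 :> F.
Proof.
move=> oF; apply/negP => /eqP two0; have := card_natr_eq0 F.
rewrite -(odd_double_half #|F|) oF natrD -mul2n natrM two0 mul0r addr0 => /eqP.
by rewrite oner_eq0.
Qed.

Lemma prime_card_natr_neq0 (F : finFieldType) : prime #|F| ->
  forall k, (0 < k < #|F|)%N -> k%:R != 0 :> F.
Proof.
move=> pF k /andP[k0 kF].
have ch : #|F| \in [pchar F] by apply: (@card_finPcharP F #|F| 1); rewrite ?expn1.
by rewrite -(dvdn_pcharf ch) gtnNdvd.
Qed.

(** Otherwise z = y / x has z^2 = -1; as (q - 1) / 2 is odd, z^(q-1) = -1,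
    against z^q = z. *)
Lemma sum_sqr_eq0 (F : finFieldType) (x y : F) : #|F| = 3 %[mod 4] ->
  x ^+ 2 + y ^+ 2 = 0 -> x = 0 /\ y = 0.
Proof.
move=> q3 xy0.
have x0 : x = 0; last first.
  by move: xy0; rewrite x0 expr0n add0r => /eqP; rewrite sqrf_eq0 => /eqP.
apply/eqP/negP => /negP x0; pose z := y / x.
have z2 : z ^+ 2 = -1.
  have -> : z ^+ 2 = (x ^+ 2 + y ^+ 2) / x ^+ 2 - 1 by rewrite /z; field.
  by rewrite xy0 mul0r add0r.
have z0 : z != 0 by rewrite -sqrf_eq0 z2 oppr_eq0 oner_eq0.
have qE : #|F| = ((#|F| %/ 4).*2.+1.*2.+1)%N.
  by rewrite [LHS](divn_eq _ 4) q3; lia.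
have oF : odd #|F| by rewrite qE /= odd_double.
have : z ^+ #|F| = z := expf_card z.
rewrite qE exprS -mul2n exprM z2 exprS -[in X in _ ^+ X]mul2n exprM.
rewrite sqrrN !expr1n !mulr1 => h; have : 2%:R * z = 0.
  by rewrite -(subrr z) -{3}h; ring.
by move/eqP; rewrite mulf_eq0 (negPf (two_neq0 oF)) (negPf z0).
Qed.

(** * Averages over all frequencies *)

Section DotProduct.
Variables (F : finFieldType) (d : nat).
Local Notation q := #|F|.
Implicit Types (x y z : 'cV[F]_d) (g : 'M[F]_d).

Definition dot x y : F := (x^T *m y) 0 0.

Lemma dotE x y : dot x y = \sum_i x i 0 * y i 0.
Proof. by rewrite /dot mxE; apply: eq_bigr => i _; rewrite mxE. Qed.

Lemma dotC x y : dot x y = dot y x.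
Proof. by rewrite !dotE; apply: eq_bigr => i _; rewrite mulrC. Qed.

Lemma dotDl x y z : dot (x + y) z = dot x z + dot y z.
Proof. by rewrite /dot linearD mulmxDl mxE. Qed.

Lemma dotDr x y z : dot x (y + z) = dot x y + dot x z.
Proof. by rewrite /dot mulmxDr mxE. Qed.

Lemma dotNr x y : dot x (- y) = - dot x y.
Proof. by rewrite /dot mulmxN mxE. Qed.

Lemma dotZr a x y : dot x (a *: y) = a * dot x y.
Proof. by rewrite /dot -scalemxAr mxE. Qed.

Lemma dot_mull g x y : dot (g *m x) y = dot x (g^T *m y).
Proof. by rewrite /dot trmx_mul mulmxA. Qed.

Lemma sqnorm_dot x : sqnorm x = dot x x.
Proof. by rewrite dotE; apply: eq_bigr => i _; rewrite expr2. Qed.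

Lemma dot_delta i x : dot (delta_mx i 0) x = x i 0.
Proof. by rewrite /dot trmx_delta -rowE mxE. Qed.

(** Polarization. *)
Lemma orthogonalP g : 2%:R != 0 :> F ->
  (g \in orthogonal_group F d) = (g^T *m g == 1%:M).
Proof.
move=> two0; rewrite inE; apply/forallP/eqP => [gO|gg x]; last first.
  by rewrite !sqnorm_dot dot_mull mulmxA gg mul1mx.
pose B := g^T *m g - 1%:M.
have B0 x : dot x (B *m x) = 0.
  rewrite mulmxBl mul1mx dotDr dotNr -mulmxA -dot_mull -!sqnorm_dot.
  by rewrite (eqP (gO x)) subrr.
have Bsym : B^T = B by rewrite /B linearB /= trmx_mul trmxK trmx1.
apply/eqP; rewrite -subr_eq0 -/B; apply/eqP/matrixP => i j; rewrite [RHS]mxE.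
have bil x y : dot x (B *m y) = 0.
  apply/(mulfI two0); rewrite mulr0.
  transitivity (dot (x + y) (B *m (x + y))); last exact: B0.
  rewrite mulmxDr !dotDl !dotDr !B0 add0r addr0 [dot y _]dotC dot_mull Bsym.
  by rewrite -mulr2n mulr_natl.
by have := bil (delta_mx i 0) (delta_mx j 0); rewrite dot_delta -colE mxE.
Qed.

Lemma card_cV : #|{: 'cV[F]_d}| = (q ^ d)%N.
Proof. by rewrite card_mx muln1. Qed.

Lemma exists_coord_neq0 z : z != 0 -> exists i, z i 0 != 0.
Proof.
move=> z0; apply/existsP; apply: contraNT z0 => /existsPn h; apply/eqP/colP => i.
by rewrite [RHS]mxE; apply/eqP; have := h i; rewrite negbK.
Qed.

(** Translating the hyperplane along a vector u with u . z = 1 tiles the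
    space. *)
Lemma card_orthogonal_hyperplane z : z != 0 ->
  (q * #|[set m | dot m z == 0%R]| = #|{: 'cV[F]_d}|)%N.
Proof.
move=> z0; have [i zi] := exists_coord_neq0 z0.
pose u : 'cV[F]_d := (z i 0)^-1 *: delta_mx i 0.
have uz : dot u z = 1 by rewrite dotC dotZr dotC dot_delta mulVf.
pose f (p : F * 'cV[F]_d) := p.1 *: u + p.2.
have fz p : dot (f p) z = p.1 + dot p.2 z.
  by rewrite dotDl [dot (_ *: _) z]dotC dotZr [dot z u]dotC uz mulr1.
rewrite -(cardsT F) -(cardsT 'cV[F]_d) -cardsX.
rewrite -(card_in_imset (f := f)) => [|p p']; last first.
  rewrite !inE /= => /eqP p0 /eqP p0' pp; have := congr1 (dot^~ z) pp.
  rewrite !fz p0 p0' !addr0 => e; move: pp; rewrite /f e => /addrI e2.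
  by rewrite [p]surjective_pairing [p']surjective_pairing e e2.
apply: eq_card => x; rewrite inE; apply/imsetP.
exists (dot x z, x - dot x z *: u); last by rewrite /f /= addrC subrK.
by rewrite !inE /= [dot (_ - _) z]dotC dotDr dotNr dotZr [dot z u]dotC uz mulr1
  [dot z x]dotC subrr.
Qed.

(** Plancherel without characters.  Exchange the sums: a pair with phi i = phi j
    collides at all q^d frequencies, any other pair at q^(d-1) of them.  The
    terms are arranged to avoid subtraction. *)
Lemma collisions_frequency_sum (T : finType) (S : {set T}) (phi : T -> 'cV[F]_d) :
  (q * \sum_m collisions (fun i => dot m (phi i)) S + q ^ d * collisions phi S =
   q ^ d * #|S| ^ 2 + q * q ^ d * collisions phi S)%N.
Proof.
rewrite -card_cV; set Q := #|{: 'cV[F]_d}|.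
under eq_bigr do rewrite collisions_sum.
rewrite exchange_big /= [collisions phi S]collisions_sum !big_distrr /=.
rewrite expnS expn1 -cardsX -sum1_card big_distrr /= -!big_split /=.
apply: eq_bigr => p _; rewrite muln1.
have -> : (\sum_(m : 'cV[F]_d) (dot m (phi p.1) == dot m (phi p.2)))%N =
    #|[set m | dot m (phi p.1 - phi p.2) == 0]|.
  rewrite -sum1_card [RHS]big_mkcond; apply: eq_bigr => m _.
  by rewrite inE dotDr dotNr subr_eq0; case: (_ == _).
have [pp|pp] := eqVneq (phi p.1) (phi p.2).
  rewrite pp !muln1 addnC; congr (_ + _ * _)%N; apply: eq_card => m.
  by rewrite !inE subrr /dot mulmx0 mxE eqxx.
by rewrite card_orthogonal_hyperplane ?subr_eq0 // !muln0 !addn0.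
Qed.

End DotProduct.
(** * Energy averaged over the orthogonal group *)

Section RotationEnergy.
Variables (F : finFieldType) (d : nat).
Local Notation q := #|F|.
Local Notation V := 'cV[F]_d.
Local Notation O := (orthogonal_group F d).

(** For a nontrivial additive character psi, this is the sum over s != 0 in F of
    the squared modulus of the Fourier coefficient of phi at s m. *)
Definition excess n (T : finType) (S : {set T}) (phi : T -> 'cV[F]_n) (m : 'cV[F]_n) : int :=
  (q * collisions (fun i => dot m (phi i)) S)%N%:Z - (#|S| ^ 2)%N%:Z.

(** Cauchy-Schwarz: m . phi takes at most q values. *)
Lemma excess_ge0 n (T : finType) (S : {set T}) (phi : T -> 'cV[F]_n) m :
  0 <= excess S phi m.
Proof.
rewrite subr_ge0 lez_nat; apply: leq_trans (sqr_card_le_collisions (fun i => dot m (phi i)) S) _.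
by rewrite leq_mul2r max_card orbT.
Qed.

Lemma excess0 n (T : finType) (S : {set T}) (phi : T -> 'cV[F]_n) :
  excess S phi 0 = (q%:Z - 1) * (#|S| ^ 2)%N%:Z.
Proof.
rewrite /excess mulrBl mul1r -PoszM; congr (_%:Z - _); congr (_ * _)%N.
rewrite expnS expn1 -cardsX; apply: eq_card => p.
by rewrite in_set /dot !linear0 !mul0mx eqxx andbT.
Qed.

Lemma sum_excess n (T : finType) (S : {set T}) (phi : T -> 'cV[F]_n) :
  \sum_m excess S phi m = (q%:Z - 1) * (q ^ n * collisions phi S)%N%:Z.
Proof.
have /(congr1 Posz) := collisions_frequency_sum S phi.
rewrite !PoszD !PoszM (big_morph Posz PoszD (erefl : Posz 0 = 0)) => h.
rewrite sumrB sumr_const card_mx muln1 -mulr_natr natz.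
under eq_bigr do rewrite PoszM.
rewrite -mulr_sumr PoszM; apply: (addIr ((#|S| * #|S|)%N%:Z * (q ^ n)%N%:Z)).
rewrite PoszM subrK.
apply: (addIr ((q ^ n)%N%:Z * (collisions phi S)%:Z)); rewrite h; ring.
Qed.

Definition rot_diff g (p : V * V) : V := p.1 - g *m p.2.
Definition stack (p : V * V) : 'cV[F]_(d + d) := col_mx p.1 p.2.

Lemma dot_col_mx (x y z t : V) : dot (col_mx x y) (col_mx z t) = dot x z + dot y t.
Proof. by rewrite /dot tr_col_mx mul_row_col mxE. Qed.

(** m . (x - g y) = m . x + (- g^T m) . y: the frequencies seen through g are
    those on the graph of - g^T. *)
Lemma excess_rot_diff g P m :
  excess P (rot_diff g) m = excess P stack (col_mx m (- (g^T *m m))).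
Proof.
rewrite /excess; congr (_%:Z - _); congr (_ * _)%N; apply: eq_card => p.
rewrite !in_set; congr (_ && (_ == _));
  by rewrite /stack dot_col_mx dotDr dotNr [dot (- _) _]dotC dotNr dotC [dot _ (g^T *m m)]dotC
     dot_mull trmxK dotC.
Qed.
Lemma stack_bij : bijective stack.
Proof.
exists (fun z => (usubmx z, dsubmx z)) => [[x y]|z]; last exact: vsubmxK.
by rewrite /stack col_mxKu col_mxKd.
Qed.

Lemma excess_rot_diff_sum P g :
  (q%:Z - 1) * ((q ^ d * collisions (rot_diff g) P)%N%:Z - (#|P| ^ 2)%N%:Z) =
  \sum_(m | m != 0) excess P stack (col_mx m (- (g^T *m m))).
Proof.
rewrite mulrBr -sum_excess (bigD1 0) //= excess0 addrC addrK.
by apply: eq_bigr => m _; rewrite excess_rot_diff.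
Qed.

(** The graphs of - g^T cover each pair (m, w) with m != 0 at most
    C |O(d)| / q^(d-1) times, and all excesses are nonnegative; so the sum over g
    is at most that multiple of the sum over all of F^(2d). *)
Lemma sum_rotation_energy (C : nat) P : (0 < d)%N -> (1 < q)%N ->
    (forall m w : V, m != 0 ->
       (#|[set g in O | g^T *m m == w]| * q ^ d.-1 <= C * #|O|)%N) ->
  (\sum_(g in O) q ^ d * collisions (rot_diff g) P <=
     #|O| * #|P| ^ 2 + C * #|O| * q ^ d.+1 * #|P|)%N.
Proof.
move=> d0 q1 HC; pose D g := (q ^ d * collisions (rot_diff g) P)%N%:Z - (#|P| ^ 2)%N%:Z.
have q1Z : 0 < q%:Z - 1 by rewrite subr_gt0.
have qdZ : 0 < (q ^ d.-1)%N%:Z by rewrite ltz_nat expn_gt0 (ltnW q1).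
pose f (m w : V) : int := excess P stack (col_mx m w).
have swap : \sum_(g in O) \sum_(m | m != 0) f m (- (g^T *m m)) =
    \sum_(m | m != 0) \sum_w #|[set g in O | g^T *m m == - w]|%:Z * f m w.
  rewrite exchange_big /=; apply: eq_bigr => m m0.
  rewrite (partition_big (fun g => - (g^T *m m)) xpredT) //=; apply: eq_bigr => w _.
  rewrite (eq_bigr (fun _ => f m w)) => [|g /andP[_ /eqP ->] //].
  rewrite sumr_const -mulr_natl natz; congr (_%:Z * _).
  by apply: eq_card => g; rewrite in_set [LHS]unfold_in eqr_oppLR.
have total : \sum_m \sum_w f m w = (q%:Z - 1) * (q ^ (d + d) * #|P|)%N%:Z.
  rewrite pair_big /= -(collisions_inj P (bij_inj stack_bij)) -sum_excess.
  by rewrite (reindex stack) //; exact: onW_bij stack_bij.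
have bound : (q ^ d.-1)%N%:Z * ((q%:Z - 1) * \sum_(g in O) D g) <=
    (C * #|O|)%N%:Z * ((q%:Z - 1) * (q ^ (d + d) * #|P|)%N%:Z).
  rewrite -total mulr_sumr (eq_bigr (fun g => \sum_(m | m != 0) f m (- (g^T *m m)))).
    rewrite swap !mulr_sumr (bigD1 0 (P := xpredT)) //= ler_wpDl //.
      by rewrite mulr_ge0 // sumr_ge0 // => w _; exact: excess_ge0.
    apply: ler_sum => m m0; rewrite !mulr_sumr; apply: ler_sum => w _.
    rewrite mulrA; apply: ler_wpM2r; first exact: excess_ge0.
    by rewrite -PoszM lez_nat mulnC HC.
  by move=> g _; rewrite -excess_rot_diff_sum.
have {bound} bound : \sum_(g in O) D g <= (C * #|O| * q ^ d.+1 * #|P|)%N%:Z.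
  rewrite -(ler_pM2l q1Z) -(ler_pM2l qdZ); apply: le_trans bound _.
  rewrite le_eqVlt; apply/orP; left; apply/eqP.
  have -> : (d + d = d.-1 + d.+1)%N by lia.
  by rewrite expnD !PoszM; ring.
rewrite -lez_nat PoszD -lerBlDl; apply: le_trans bound.
rewrite /D sumrB sumr_const (big_morph Posz PoszD (erefl : Posz 0 = 0)).
by rewrite -mulr_natl natz PoszM.
Qed.
Definition reflection (v : V) : 'M[F]_d := 1%:M - (2%:R / dot v v) *: (v *m v^T).

Lemma mul_reflection v x : reflection v *m x = x - (2%:R * dot v x / dot v v) *: v.
Proof.
rewrite mulmxBl mul1mx -scalemxAl -mulmxA [v^T *m x]mx11_scalar mul_mx_scalar.
by rewrite scalerA -/(dot v x) mulrAC.
Qed.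

Lemma reflection_sym v : (reflection v)^T = reflection v.
Proof. by rewrite linearB linearZ /= trmx1 trmx_mul trmxK. Qed.

Lemma reflectionK v : dot v v != 0 -> reflection v *m reflection v = 1%:M.
Proof.
move=> vv; set a := 2%:R / dot v v; set M := v *m v^T.
have MM : M *m M = dot v v *: M.
  by rewrite /M -mulmxA (mulmxA v^T) [v^T *m v]mx11_scalar mul_scalar_mx scalemxAr.
rewrite /reflection -/a -/M mulmxBl mul1mx mulmxBr mulmx1 -scalemxAl -scalemxAr MM.
have acc : a * (a * dot v v) = a + a by rewrite /a divfK //; ring.
by rewrite !scalerA -mulrA acc scalerDl opprB addrK subrK.
Qed.

(** A line parallel to a coordinate axis meets the isotropic cone in at most two
    points, as the equation in the coordinate is monic of degree 2. *)
Lemma card_isotropic (i : 'I_d) : (q * #|[set v : V | dot v v == 0%R]| <= 2 * q ^ d)%N.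
Proof.
pose f (p : F * V) := p.1 *: delta_mx i 0 + p.2.
rewrite -card_cV -(cardsT F) -cardsX -(cardsT 'cV[F]_d).
apply: (leq_card_fibers (f := f)) => [p|x _]; first by rewrite inE.
have [->|[[t0 v0]]] := set_0Vmem [set p in setX [set: F] [set v : V | dot v v == 0] | f p == x].
  by rewrite cards0.
rewrite !inE /= => /andP[/eqP v00 /eqP fx0].
have vE (t : F) (v : V) : f (t, v) = x -> v = x - t *: delta_mx i 0.
  by rewrite /f /= => <-; rewrite addrAC subrr add0r.
have dotE' (t : F) : dot (x - t *: delta_mx i 0) (x - t *: delta_mx i 0) =
    dot x x - 2%:R * t * x i 0 + t ^+ 2.
  rewrite dotDr dotNr dotZr ![dot (_ - _) _]dotC !dotDr !dotNr !dotZr dot_delta.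
  rewrite [dot x (delta_mx _ _)]dotC !dot_delta mxE !eqxx /=; ring.
pose h (t : F) := (t, x - t *: delta_mx i 0 : V).
apply: (@leq_trans #|h @: [set t0; 2%:R * x i 0 - t0]|); last first.
  by apply: leq_trans (leq_imset_card _ _) _; rewrite cards2; case: (_ != _).
apply/subset_leq_card/subsetP => -[t v]; rewrite !inE /= => /andP[/eqP vv /eqP fx].
apply/imsetP; exists t; last by rewrite /h -(vE _ _ fx).
move: vv v00; rewrite (vE _ _ fx) (vE _ _ fx0) !dotE' => vv v00; rewrite !inE.
have : (t - t0) * (t - (2%:R * x i 0 - t0)) == 0.
  apply/eqP; apply: etrans (subrr 0); rewrite -{1}vv -v00; ring.
by rewrite mulf_eq0 !subr_eq0.
Qed.

(** Compose the elements g with the reflections in vectors v such that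
    v . m != 0 and v . v != 0, which are at least half of all vectors when
    q > 5.  The product h determines the image of m under the reflection, hence
    v up to a factor, hence at most q pairs (v, g).  For q <= 5 the constant 5^d
    makes the bound trivial. *)
Lemma card_orthogonal_sending_le (m w : V) : odd q -> m != 0 ->
  (#|[set g in O | g^T *m m == w]| * q ^ d.-1 <= 5 ^ d * #|O|)%N.
Proof.
move=> oq m0; have two0 : 2%:R != 0 :> F := two_neq0 oq.
have [i _] := exists_coord_neq0 m0.
have d0 : (0 < d)%N by apply: leq_trans (ltn_ord i).
set K := [set g in O | _].
have KO : (#|K| <= #|O|)%N by apply/subset_leq_card/subsetP => g; rewrite inE => /andP[].
have [q5|q5] := leqP q 5.
  rewrite mulnC leq_mul //; apply: (@leq_trans (5 ^ d.-1)).
    by case: (d.-1) => [|n]; rewrite ?expn0 // leq_exp2r.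
  by rewrite leq_exp2l // leq_pred.
pose H := [set v : V | dot v m == 0]; pose Z := [set v : V | dot v v == 0].
pose G := ~: (H :|: Z).
have GP v : (v \in G) = (dot v m != 0) && (dot v v != 0).
  by rewrite /G !in_setC in_setU negb_or [in LHS]in_set [v \in Z]in_set.
have KP g : (g \in K) = (g \in O) && (g^T *m m == w) by rewrite [LHS]in_set.
have G2 : (q ^ d <= 2 * #|G|)%N.
  have := cardsC (H :|: Z); rewrite -/G card_cV.
  have := card_orthogonal_hyperplane m0; rewrite -/H card_cV.
  have := card_isotropic i; rewrite -/Z.
  have := (leq_card_setU H Z).1.
  move: #|H| #|Z| #|H :|: Z| #|G| (q ^ d)%N => a b c e Q h1 h2 h3 h4.
  by nia.
suff GK : (#|setX G K| <= q * #|O|)%N.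
  have q0 : (0 < q)%N by apply: leq_trans q5.
  rewrite -(leq_pmul2l q0).
  rewrite mulnCA -expnS prednK //.
  apply: (@leq_trans (2 * #|setX G K|)).
    by rewrite cardsX mulnC mulnA leq_mul2r G2 orbT.
  apply: (@leq_trans (2 * (q * #|O|))); first by rewrite leq_mul2l GK.
  rewrite mulnCA !leq_mul2l leq_mul2r.
  suff -> : (2 <= 5 ^ d)%N by rewrite !orbT.
  by apply: (@leq_trans (5 ^ 1)); rewrite // leq_exp2l.
apply: (leq_card_fibers (f := fun p => reflection p.1 *m p.2)) => [[v g]|h hO].
  rewrite in_setX GP KP /= => /andP[/andP[_ vv] /andP[gO _]]; rewrite orthogonalP //.
  rewrite trmx_mul reflection_sym -mulmxA [X in _ *m X]mulmxA reflectionK // mul1mx.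
  by rewrite -orthogonalP.
set X := [set p in _ | _].
have XP p : p \in X -> [/\ dot p.1 m != 0, dot p.1 p.1 != 0,
    reflection p.1 *m m = h *m w & p.2 = reflection p.1 *m h].
  case: p => v g; rewrite in_set in_setX GP KP /=.
  move=> /andP[/andP[/andP[vm vv] /andP[gO /eqP gm]] /eqP hE]; split=> //.
    rewrite -hE -mulmxA -gm; move: gO; rewrite orthogonalP // => /eqP /mulmx1C gg.
    by rewrite [g *m _]mulmxA gg mul1mx.
  by rewrite -hE mulmxA reflectionK ?mul1mx.
have [->|[[v0 g0] /XP[/= vm0 vv0 rm0 _]]] := set_0Vmem X; first by rewrite cards0.
pose r (a : F) := (a *: v0, reflection (a *: v0) *m h).
apply: (@leq_trans #|r @: setT|); last first.
  by apply: leq_trans (leq_imset_card _ _) _; rewrite cardsT.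
apply/subset_leq_card/subsetP => -[v g] /XP[/= vm vv rm gE].
pose c (u : V) := 2%:R * dot u m / dot u u.
have c0 : c v != 0 by rewrite !mulf_neq0 ?invr_eq0.
have vE : v = (c v0 / c v) *: v0.
  apply: (scalerI c0); rewrite scalerA mulrC divfK //.
  by move: rm; rewrite -rm0 !mul_reflection => /addrI /oppr_inj.
by apply/imsetP; exists (c v0 / c v); rewrite ?inE // /r -vE -gE.
Qed.

(** Compare E_g q^d >= |P|^2, valid for all g, and E_g q^d >= (C + 1) |P|^2,
    valid on E, with the average over O(d): the main terms |O(d)| |P|^2
    cancel. *)
Lemma card_exceptional_le (C : nat) (P : {set V * V}) (E : {set 'M[F]_d}) :
    (0 < C)%N -> (0 < d)%N -> (1 < q)%N ->
    (forall m w : V, m != 0 ->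
       (#|[set g in O | g^T *m m == w]| * q ^ d.-1 <= C * #|O|)%N) ->
    P != set0 -> E \subset O ->
    (forall g, g \in E -> (C.+1 * #|rotated_diff g P| <= q ^ d)%N) ->
  (#|E| * #|P| <= q ^ d.+1 * #|O|)%N.
Proof.
move=> C0 d0 q1 HC P0 EO HE; have := sum_rotation_energy P d0 q1 HC.
have each g : (#|P| ^ 2 + (g \in E) * (C * #|P| ^ 2) <= q ^ d * collisions (rot_diff g) P)%N.
  have CS := sqr_card_le_collisions (rot_diff g) P.
  case: (boolP (g \in E)) => gE; last first.
    rewrite mul0n addn0; apply: leq_trans CS _; rewrite leq_mul2r.
    by rewrite -card_cV max_card orbT.
  rewrite mul1n -mulSn.
  apply: (@leq_trans (C.+1 * (#|rot_diff g @: P| * collisions (rot_diff g) P))).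
    by rewrite leq_mul2l CS.
  by rewrite mulnA leq_mul2r HE ?orbT.
have sumE : (\sum_(g in O) (g \in E) * (C * #|P| ^ 2) = #|E| * (C * #|P| ^ 2))%N.
  rewrite -big_distrl /=; congr (_ * _)%N.
  rewrite -sum1_card [LHS]big_mkcond [RHS]big_mkcond; apply: eq_bigr => g _.
  by have := subsetP EO g; case: (g \in E) => [->|_] //; case: (_ \in _).
have : (#|O| * #|P| ^ 2 + #|E| * (C * #|P| ^ 2) <=
   \sum_(g in O) q ^ d * collisions (rot_diff g) P)%N.
  by rewrite -sumE -sum_nat_const -big_split; apply: leq_sum => g _.
move=> low high; have := leq_trans low high; rewrite leq_add2l.
have P1 : (0 < #|P|)%N by rewrite card_gt0.
have CP : (0 < C * #|P|)%N by rewrite muln_gt0 C0.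
move=> h; rewrite -(leq_pmul2r CP); apply: leq_trans (leq_trans h _).
  by rewrite expnS expn1 (mulnCA C) -mulnA.
rewrite leq_eqVlt; apply/orP; left; apply/eqP.
by move: (q ^ _)%N #|O| #|P| => x y z; ring.
Qed.
End RotationEnergy.

(** * Polynomials restricted to lines *)

Section LineRestriction.
Variables (n : nat) (F : fieldType).
Implicit Types (p : {mpoly F[n]}) (u v : 'I_n -> F).

Definition line_restr u v p : {poly F} :=
  mmap polyC (fun i => (u i)%:P + (v i)%:P * 'X) p.

Lemma horner_line_restr u v p y :
  (line_restr u v p).[y] = p.@[fun i => u i + v i * y].
Proof.
rewrite /line_restr /mmap mevalE horner_sum; apply: eq_bigr => m _.
rewrite hornerM hornerC /mmap1 horner_prod; congr (_ * _).
by apply: eq_bigr => i _; rewrite horner_exp hornerD hornerC hornerCM hornerX.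
Qed.

Lemma size_line_restr u v p : (size (line_restr u v p) <= msize p)%N.
Proof.
apply: (leq_trans (size_sum _ _ _)); apply/bigmax_leqP_seq => m mp _.
apply: leq_trans (msize_mdeg_lt mp); apply: (leq_trans (size_polyMleq _ _)).
rewrite /mmap1 mdegE.
have h1 := size_polyC_leq1 (p@_m).
suff h2 : (size (\prod_i ((u i)%:P + (v i)%:P * 'X) ^+ m i)%R
           <= (\sum_i m i).+1)%N.
  apply: leq_trans h2.
  by case: (size (p@_m)%:P) h1 => [|[|]] //= _; rewrite add0n leq_pred.
elim/big_ind2: _ => [|a1 b1 a2 b2 h h'|i _]; first by rewrite size_poly1.
  by apply: (leq_trans (size_polyMleq _ _)); lia.
apply: (leq_trans (size_poly_exp_leq _ _)).
have : (size ((u i)%:P + (v i)%:P * 'X)%R <= 2)%N.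
  apply: (leq_trans (size_polyD _ _)); rewrite geq_max.
  rewrite (leq_trans (size_polyC_leq1 _)) //=.
  by apply: (leq_trans (size_polyMleq _ _)); rewrite size_polyX size_polyC; case: eqP.
by nia.
Qed.

HB.instance Definition _ u v := GRing.RMorphism.copy (line_restr u v)
  (mmap polyC (fun i => (u i)%:P + (v i)%:P * 'X : {poly F})).

(** Chain rule.  Both sides are derivations, so products and variables
    suffice. *)
Lemma deriv_line_restr u v p :
  (line_restr u v p)^`() = \sum_i (v i)%:P * line_restr u v p^`M(i).
Proof.
pose D p := (line_restr u v p)^`() = \sum_i (v i)%:P * line_restr u v p^`M(i).
rewrite -/(D p).
have Dm p1 p2 : D p1 -> D p2 -> D (p1 * p2).
  rewrite /D => h1 h2; rewrite rmorphM derivM h1 h2 mulr_suml mulr_sumr -big_split.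
  apply: eq_bigr => i _ /=; rewrite mderivM rmorphD !rmorphM /=; ring.
have DC c : D c%:MP.
  rewrite /D /line_restr mmapC derivC big1 // => i _.
  by rewrite mderivC mmap0 mulr0.
have submm i : (U_(i) - U_(i) = 0 :> 'X_{1..n})%MM.
  by apply/mnmP => j; rewrite mnmBE subnn mnm0E.
have DX i : D 'X_i.
  rewrite /D /line_restr mmapX mmap1U derivD derivM !derivC derivX mul0r !add0r mulr1.
  rewrite (bigD1 i) //= mderivX mnm1E eqxx scale1r submm.
  rewrite mmapX mmap11 mulr1 big1 ?addr0 // => j ji.
  by rewrite mderivX mnm1E eq_sym (negPf ji) scale0r mmap0 mulr0.
elim/mpolyind: p => [|c m p _ _ IH].
  by rewrite -[0]/(0%:MP); exact: (DC).
suff h : D (c *: 'X_[m]).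
  rewrite /D !raddfD /= h IH -big_split; apply: eq_bigr => i _ /=.
  by rewrite raddfD /= [in RHS]rmorphD mulrDr.
rewrite -mul_mpolyC; apply: (Dm) => //; rewrite mpolyXE_id.
elim/big_ind: _ => [|p1 p2|i _]; [by rewrite -[1]/(1%:MP); exact: (DC)|exact: (Dm)|].
elim: (m i) => [|k IHk]; first by rewrite expr0 -[1]/(1%:MP); exact: (DC).
by rewrite exprS; apply: (Dm).
Qed.

End LineRestriction.
Lemma msize_mderiv n (F : fieldType) (p : {mpoly F[n]}) i :
  (msize p^`M(i) <= (msize p).-1)%N.
Proof.
rewrite [X in (X <= _)%N]msizeE; apply/bigmax_leqP_seq => m.
rewrite mcoeff_msupp mcoeff_mderiv => mp _.
suff /msize_mdeg_lt : (m + U_(i))%MM \in msupp p by rewrite mdegD mdeg1; lia.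
by rewrite mcoeff_msupp; apply: contraNneq mp => ->; rewrite mul0rn.
Qed.

(** Below degree q no exponent is divisible by the characteristic. *)
Lemma mderiv_eq0_const n (F : fieldType) (q : nat) (p : {mpoly F[n]}) :
    (forall k, (0 < k < q)%N -> k%:R != 0 :> F) -> (msize p <= q)%N ->
    (forall i, p^`M(i) = 0) ->
  p = (p@_0%MM)%:MP.
Proof.
move=> charF sp dp; apply/mpolyP => m; rewrite mcoeffC.
have [->|m0] := eqVneq m 0%MM; first by rewrite mulr1.
rewrite mulr0; apply: contraNeq m0 => pm.
apply/eqP/mnmP => i; rewrite mnm0E; apply/eqP; case: (posnP (m i)) => // mi0.
have mU : ((m - U_(i)) + U_(i) = m)%MM.
  apply/mnmP => j; rewrite mnmDE mnmBE mnm1E.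
  by case: eqP => [<-|]; rewrite ?subnK ?subn0 ?addn0.
have := mcoeff_mderiv i p (m - U_(i)); rewrite dp mcoeff0 mU mnmBE mnm1E eqxx.
rewrite subn1 prednK // -mulr_natr => /esym/eqP; rewrite mulf_eq0 (negPf pm) /=.
rewrite (negPf (charF _ _)) // mi0 /=.
have : (mdeg m < msize p)%N by rewrite msize_mdeg_lt // mcoeff_msupp.
rewrite mdegE (bigD1 i) //=; move: (\sum_(_ | _) _)%N; lia.
Qed.

(** The monomials with all exponents below k are k^n unknown coefficients,
    against #|X| linear conditions. *)
Lemma exists_vanishing_mpoly n k (F : fieldType) (T : finType) (X : {set T})
    (pt : T -> 'I_n -> F) :
    (#|X| < k ^ n)%N ->
  exists H : {mpoly F[n]}, [/\ H != 0, (msize H <= (n * k.-1).+1)%N &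
    forall x, x \in X -> H.@[pt x] = 0].
Proof.
move=> Xk; pose mon (f : {ffun 'I_n -> 'I_k}) := [multinom (f i : nat) | i < n].
have mon_inj : injective mon.
  move=> f g /mnmP fg; apply/ffunP => i; apply/val_inj.
  by have := fg i; rewrite !mnmE.
pose N := #|{: {ffun 'I_n -> 'I_k}}|.
pose M : 'M[F]_(N, #|X|) := \matrix_(i, j) ('X_[mon (enum_val i)]).@[pt (enum_val j)].
have kerM : kermx M != 0.
  rewrite kermx_eq0 /row_free; apply: contraTneq Xk => rM.
  have := rank_leq_col M; rewrite rM /N card_ffun !card_ord; lia.
have [v /sub_kermxP vM v0] := rowV0Pn kerM.
pose H : {mpoly F[n]} := \sum_i v 0 i *: 'X_[mon (enum_val i)].
exists H; split.
- apply: contra_neq v0 => H0; apply/rowP => i; rewrite mxE.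
  have := congr1 (mcoeff (mon (enum_val i))) H0; rewrite mcoeff0 => <-.
  rewrite raddf_sum (bigD1 i) //= mcoeffZ mcoeffX eqxx mulr1 big1 ?addr0 // => j ji.
  rewrite mcoeffZ mcoeffX (inj_eq mon_inj) (inj_eq enum_val_inj) (negPf ji).
  exact: mulr0.
- apply: (leq_trans (msize_sum _ _ _)); apply/bigmax_leqP => i _.
  apply: (leq_trans (msizeZ_le _ _)); rewrite msizeX ltnS mdegE.
  apply: (@leq_trans (\sum_(j < n) k.-1)); last first.
    by rewrite sum_nat_const card_ord.
  apply: leq_sum => j _; rewrite mnmE.
  by rewrite -ltnS (leq_trans (ltn_ord _)) ?leqSpred.
move=> x xX; have := congr1 (fun A : 'rV_ _ => A 0 (enum_rank_in xX x)) vM.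
rewrite !mxE => vMx; rewrite -[RHS]vMx /H raddf_sum; apply: eq_bigr => i _ /=.
by rewrite mevalZ mxE enum_rankK_in.
Qed.

(** Second order condition at a point on three lines of a surface.  Here
    h = (h1, h2) is the horizontal gradient, v and w are the differences between
    the direction of the first line and those of the other two, and (A, B) is the
    derivative of the gradient along the first line.  If h != 0 then v and w are
    different multiples of (h2, - h1); the last two hypotheses are then two
    equations r (2 c + r Q) = 0 with the same c and Q and two different nonzero values of
    r, which forces c = h2 A - h1 B = 0. *)
Lemma wronskian_three_tangents (F : fieldType) (h1 h2 A B h11 h12 h22 v1 v2 w1 w2 : F) :
    2%:R != 0 :> F -> (v1, v2) != (0, 0) -> (w1, w2) != (0, 0) ->
    (v1, v2) != (w1, w2) ->
    v1 * h1 + v2 * h2 = 0 -> w1 * h1 + w2 * h2 = 0 ->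
    2%:R * (v1 * A + v2 * B) + (v1 ^+ 2 * h11 + 2%:R * v1 * v2 * h12 + v2 ^+ 2 * h22) = 0 ->
    2%:R * (w1 * A + w2 * B) + (w1 ^+ 2 * h11 + 2%:R * w1 * w2 * h12 + w2 ^+ 2 * h22) = 0 ->
  h1 * B = h2 * A.
Proof.
move=> two0 v0 w0 vw hv hw qv qw.
have [/andP[/eqP-> /eqP->]|h0] := boolP ((h1 == 0) && (h2 == 0)); first by rewrite !mul0r.
have par x1 x2 : x1 * h1 + x2 * h2 = 0 -> exists r, x1 = r * h2 /\ x2 = - (r * h1).
  move=> hx; have [h20|h20] := eqVneq h2 0.
    move: h0 hx; rewrite h20 eqxx andbT mulr0 addr0 => h10 /eqP.
    rewrite mulf_eq0 (negPf h10) orbF => /eqP ->.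
    by exists (- x2 / h1); rewrite mulr0 divfK // opprK.
  exists (x1 / h2); rewrite divfK //; split=> //.
  have -> : x2 = (x1 * h1 + x2 * h2 - x1 * h1) / h2 by field.
  by rewrite hx; field.
have [r [v1E v2E]] := par _ _ hv; have [s [w1E w2E]] := par _ _ hw.
pose c := h2 * A - h1 * B; pose Q := h2 ^+ 2 * h11 - 2%:R * h1 * h2 * h12 + h1 ^+ 2 * h22.
have r0 : r != 0 by apply: contraNneq v0 => r0; rewrite v1E v2E r0 !mul0r oppr0.
have s0 : s != 0 by apply: contraNneq w0 => s0; rewrite w1E w2E s0 !mul0r oppr0.
have rs : r - s != 0.
  by rewrite subr_eq0; apply: contraNneq vw => rs; rewrite v1E v2E w1E w2E rs.
have er : r * (2%:R * c + r * Q) = 0 by rewrite -[RHS]qv v1E v2E /c /Q; ring.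
have es : s * (2%:R * c + s * Q) = 0 by rewrite -[RHS]qw w1E w2E /c /Q; ring.
move/eqP: er; rewrite mulf_eq0 (negPf r0) /= => /eqP er.
move/eqP: es; rewrite mulf_eq0 (negPf s0) /= => /eqP es.
have Q0 : Q = 0.
  apply/eqP; suff: (r - s) * Q == 0 by rewrite mulf_eq0 (negPf rs).
  have -> : (r - s) * Q = (2%:R * c + r * Q) - (2%:R * c + s * Q) by ring.
  by rewrite er es subr0.
move/eqP: er; rewrite Q0 mulr0 addr0 mulf_eq0 (negPf two0) /= subr_eq0.
by move/eqP.
Qed.

Lemma deriv_eq0_size (F : fieldType) (q : nat) (p : {poly F}) :
    (forall k, (0 < k < q)%N -> k%:R != 0 :> F) -> (size p <= q)%N ->
  p^`() = 0 -> (size p <= 1)%N.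
Proof.
move=> charF sp dp; apply/leq_sizeP => -[//|j _].
have [jq|qj] := ltnP j.+1 q; last by rewrite nth_default // (leq_trans sp).
have := coef_deriv p j; rewrite dp coef0 -mulr_natr => /esym/eqP.
by rewrite mulf_eq0 (negPf (charF _ _)) ?orbF // => /eqP.
Qed.

(** After division by gcd(a, b) the two quotients are coprime and still have zero
    Wronskian, so each divides its own derivative; since the degrees are below
    the characteristic, the quotients are constant. *)
Lemma wronskian_eq0_proportional (F : fieldType) (q : nat) (a b : {poly F}) :
    (forall k, (0 < k < q)%N -> k%:R != 0 :> F) ->
    (size a <= q)%N -> (size b <= q)%N -> (a != 0) || (b != 0) ->
    a * b^`() = a^`() * b ->
  exists n1 n2 (g : {poly F}), [/\ (n1, n2) != (0, 0) :> F * F, g != 0,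
     (size g <= maxn (size a) (size b))%N, a = n1 *: g & b = n2 *: g].
Proof.
move=> charF sa sb ab0 wr; pose g := gcdp a b.
pose a0 := a %/ g; pose b0 := b %/ g.
have aE : a = a0 * g by rewrite divpK ?dvdp_gcdl.
have bE : b = b0 * g by rewrite divpK ?dvdp_gcdr.
have cop : coprimep a0 b0 by apply: coprimep_div_gcd.
have g0 : g != 0 by rewrite gcdp_eq0 -negb_and in ab0 *.
have wr0 : a0 * b0^`() = a0^`() * b0.
  have : g ^+ 2 * (a0 * b0^`() - a0^`() * b0) = a * b^`() - a^`() * b.
    by rewrite aE bE !derivM; ring.
  rewrite wr subrr => /eqP; rewrite mulf_eq0 expf_eq0 (negPf g0) andbF /=.
  by rewrite subr_eq0 => /eqP.
have const (c : {poly F}) : c %| c^`() -> (size c <= q)%N -> c = (c`_0)%:P.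
  move=> cd sc; apply: size1_polyC; apply: (deriv_eq0_size charF sc).
  have [->|c0] := eqVneq c 0; first by rewrite deriv0.
  apply/eqP/(contraTT _ cd) => dc0; apply/negP => /(dvdp_leq dc0).
  by rewrite leqNgt lt_size_deriv.
have le0 (c : {poly F}) : (size (c %/ g)%R <= size c)%N by rewrite leq_divp.
have a0E : a0 = (a0`_0)%:P.
  apply: const; last exact: leq_trans (le0 a) sa.
  by rewrite -(Gauss_dvdpl _ cop) -wr0 dvdp_mulr.
have b0E : b0 = (b0`_0)%:P.
  apply: const; last exact: leq_trans (le0 b) sb.
  by rewrite coprimep_sym in cop; rewrite -(Gauss_dvdpr _ cop) wr0 dvdp_mull.
exists a0`_0, b0`_0, g; split=> //.
- apply: contraTneq ab0 => -[a00 b00].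
  by rewrite aE bE a0E b0E a00 b00 !mul0r eqxx.
- rewrite leq_max; case/orP: ab0 => n0.
    by rewrite dvdp_leq ?dvdp_gcdl.
  by rewrite orbC dvdp_leq ?dvdp_gcdr.
- by rewrite -mul_polyC -a0E.
- by rewrite -mul_polyC -b0E.
Qed.

(** * Unions of lines in space over a prime field *)

Section LinesInSpace.
Variables (F : finFieldType) (T U : finType).
Implicit Types (L : {set T}) (l : T) (y : F) (H : {mpoly F[3]}).
(* The line l is y -> (y, e1 l + d1 l y, e2 l + d2 l y).  Lines of the same colour
   are never coplanar, so a plane contains at most one line of each colour; for
   rotations the colour of the line of (a, b) is a. *)
Variables (e1 e2 d1 d2 : T -> F) (col : T -> U).

Local Notation q := #|F|.

Definition at_height (l : T) (y : F) : F * F := (e1 l + d1 l * y, e2 l + d2 l * y).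

Definition space_point (y : F) (s : F * F) (i : 'I_3) : F :=
  nth 0 [:: y; s.1; s.2] i.

Definition restr (l : T) : {mpoly F[3]} -> {poly F} :=
  line_restr (fun i : 'I_3 => nth 0 [:: 0; e1 l; e2 l] i)
             (fun i : 'I_3 => nth 0 [:: 1; d1 l; d2 l] i).

Definition mult (L : {set T}) (y : F) (s : F * F) : nat :=
  #|[set l in L | at_height l y == s]|.

Definition rich (L : {set T}) (l : T) : {set F} :=
  [set y | (2 < mult L y (at_height l y))%N].

Hypothesis charF : forall k, (0 < k < q)%N -> k%:R != 0 :> F.
Hypothesis q_gt2 : (2 < q)%N.
Hypothesis line_inj : forall l l', e1 l = e1 l' -> e2 l = e2 l' ->
  d1 l = d1 l' -> d2 l = d2 l' -> l = l'.
Hypothesis col_skew : forall l l' (n1 n2 : F), col l = col l' -> (n1, n2) != (0, 0) ->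
  n1 * (e1 l - e1 l') + n2 * (e2 l - e2 l') = 0 ->
  n1 * (d1 l - d1 l') + n2 * (d2 l - d2 l') = 0 -> l = l'.

(* Some proofs forget the values of these indices, to keep conversion from
   computing with them. *)
Let v0 : 'I_3 := inord 0.
Let v1 : 'I_3 := inord 1.
Let v2 : 'I_3 := inord 2.

Lemma big_ord3 (V : nmodType) (f : 'I_3 -> V) : \sum_i f i = f v0 + f v1 + f v2.
Proof.
by rewrite !big_ord_recr big_ord0 /= add0r; congr (f _ + f _ + f _);
  apply: val_inj; rewrite /= inordK.
Qed.

Lemma horner_restr l H y : (restr l H).[y] = H.@[space_point y (at_height l y)].
Proof.
rewrite horner_line_restr; apply: meval_eq => -[[|[|[|//]]] ?] /=.
- by rewrite add0r mul1r.
- by [].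
- by [].
Qed.

Lemma deriv_restr l H : (restr l H)^`() =
  restr l H^`M(v0) + (d1 l)%:P * restr l H^`M(v1) + (d2 l)%:P * restr l H^`M(v2).
Proof. by rewrite deriv_line_restr big_ord3 /= !inordK //= mul1r. Qed.

Definition grad (l : T) H (y : F) (i : 'I_3) : F :=
  H^`M(i).@[space_point y (at_height l y)].

Lemma horner_deriv_restr l H y :
  (restr l H)^`().[y] = grad l H y v0 + d1 l * grad l H y v1 + d2 l * grad l H y v2.
Proof. by clearbody v0 v1 v2; rewrite deriv_restr !hornerD !hornerCM !horner_restr. Qed.

Lemma horner_deriv2_restr l H y : (restr l H)^`()^`().[y] =
  (restr l H^`M(v0))^`().[y] + d1 l * (restr l H^`M(v1))^`().[y]
  + d2 l * (restr l H^`M(v2))^`().[y].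
Proof.
clearbody v0 v1 v2.
by rewrite deriv_restr !derivD !derivM !derivC !mul0r !add0r !hornerD !hornerCM.
Qed.

Lemma at_height_inj l l' y y' : y != y' -> at_height l y = at_height l' y ->
  at_height l y' = at_height l' y' -> l = l'.
Proof.
move=> yy' [h1 h2] [h1' h2'].
have aux (a b c d : F) : a + b * y = c + d * y -> a + b * y' = c + d * y' -> a = c /\ b = d.
  move=> h h'; have bd : b = d.
    apply/eqP; rewrite -subr_eq0; have : (b - d) * (y - y') == 0.
      have -> : (b - d) * (y - y') = (a + b * y - (c + d * y)) - (a + b * y' - (c + d * y')).
        by ring.
      by rewrite h h' !subrr.
    by rewrite mulf_eq0 [y - y' == 0]subr_eq0 (negPf yy') orbF.
  by split=> //; move: h; rewrite bd => /addIr.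
have [? ?] := aux _ _ _ _ h1 h1'; have [? ?] := aux _ _ _ _ h2 h2'.
exact: line_inj.
Qed.

Lemma dir_neq l l' y : l != l' -> at_height l y = at_height l' y ->
  (d1 l' - d1 l, d2 l' - d2 l) != (0, 0).
Proof.
move=> ll' [h1 h2]; apply: contraNneq ll' => -[/eqP].
rewrite subr_eq0 => /eqP dd1 /eqP; rewrite subr_eq0 => /eqP dd2.
apply/eqP/line_inj => //; first by move: h1; rewrite dd1 => /addIr.
by move: h2; rewrite dd2 => /addIr.
Qed.

Lemma three_lines L l y : l \in L -> y \in rich L l ->
  exists l' l'', [/\ l' \in L, l'' \in L, l' != l, l'' != l & l' != l''] /\
    at_height l' y = at_height l y /\ at_height l'' y = at_height l y.
Proof.
move=> lL; rewrite inE /mult (cardsD1 l) inE lL eqxx /= add1n ltnS => h.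
have /card_gt1P [l' [l'' []]] := h; rewrite !inE.
move=> /and3P[? ? /eqP ?] /and3P[? ? /eqP ?] ?.
by exists l', l''.
Qed.

(** Compare the first and second derivatives of the zero polynomials H|l, H|l'
    and H|l'' at the common point. *)
Lemma rich_wronskian L H l y :
    (forall l, l \in L -> restr l H = 0) -> l \in L -> y \in rich L l ->
  let a := restr l H^`M(v1) in let b := restr l H^`M(v2) in
  (a * b^`() - a^`() * b).[y] = 0.
Proof.
clearbody v0 v1 v2; move=> HL lL yR a b.
have [l' [l'' [[l'L l''L n1 n2 n3] [p1 p2]]]] := three_lines lL yR.
pose h := grad l H y; pose hh i := grad l H^`M(i) y.
have gradE m K : at_height m y = at_height l y -> grad m K y = grad l K y.
  by move=> pm; rewrite /grad pm.
have first_order m : m \in L -> at_height m y = at_height l y ->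
    h v0 + d1 m * h v1 + d2 m * h v2 = 0.
  move=> mL pm; have := horner_deriv_restr m H y.
  by rewrite (HL m mL) deriv0 horner0 (gradE _ _ pm) => ->.
have hhC i j : hh i j = hh j i by rewrite /hh /grad mderiv_comm.
have second_order m : m \in L -> at_height m y = at_height l y ->
    hh v0 v0 + d1 m ^+ 2 * hh v1 v1 + d2 m ^+ 2 * hh v2 v2 +
    2%:R * (d1 m * hh v1 v0 + d2 m * hh v2 v0 + d1 m * d2 m * hh v1 v2) = 0.
  move=> mL pm; have := horner_deriv2_restr m H y.
  rewrite (HL m mL) !deriv0 horner0 => ->.
  rewrite !horner_deriv_restr !(gradE _ _ pm) -/(hh v0) -/(hh v1) -/(hh v2).
  by rewrite (hhC v0 v1) (hhC v0 v2) (hhC v2 v1); clearbody hh; ring.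
have aE : a^`().[y] = hh v1 v0 + d1 l * hh v1 v1 + d2 l * hh v1 v2.
  by rewrite horner_deriv_restr.
have bE : b^`().[y] = hh v2 v0 + d1 l * hh v1 v2 + d2 l * hh v2 v2.
  by rewrite horner_deriv_restr (hhC v1 v2).
have -> : (a * b^`() - a^`() * b).[y] = h v1 * b^`().[y] - h v2 * a^`().[y].
  by rewrite hornerD hornerN !hornerM !horner_restr [X in _ - X]mulrC.
apply/eqP; rewrite aE bE subr_eq0; apply/eqP.
clear aE bE hhC gradE; clearbody h hh.
have l1 := first_order _ lL erefl; have l2 := second_order _ lL erefl.
have l1' := first_order _ l'L p1; have l2' := second_order _ l'L p1.
have l1'' := first_order _ l''L p2; have l2'' := second_order _ l''L p2.
apply: (@wronskian_three_tangents F _ _ _ _ (hh v1 v1) (hh v1 v2) (hh v2 v2)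
         (d1 l' - d1 l) (d2 l' - d2 l) (d1 l'' - d1 l) (d2 l'' - d2 l)).
- by apply: charF; rewrite q_gt2.
- by apply: dir_neq (esym p1); rewrite eq_sym.
- by apply: dir_neq (esym p2); rewrite eq_sym.
- have := dir_neq n3 (etrans p1 (esym p2)); apply: contraNneq => -[E1 E2].
  apply/eqP; congr (_, _); apply/eqP; rewrite subr_eq0; apply/eqP.
    by apply: (addIr (- d1 l)).
  by apply: (addIr (- d2 l)).
- by apply: etrans (subrr 0); rewrite -{1}l1' -l1; ring.
- by apply: etrans (subrr 0); rewrite -{1}l1'' -l1; ring.
- by apply: etrans (subrr 0); rewrite -{1}l2' -l2; ring.
- by apply: etrans (subrr 0); rewrite -{1}l2'' -l2; ring.
Qed.

Lemma poly_eq0_on_set (p : {poly F}) (S : {set F}) :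
  (forall y, y \in S -> p.[y] = 0) -> (size p <= #|S|)%N -> p = 0.
Proof.
move=> pS sp; apply: contraTeq sp => p0; rewrite -ltnNge cardE.
apply: max_poly_roots; rewrite ?enum_uniq //.
by apply/allP => y; rewrite mem_enum => /pS py; apply/rootP.
Qed.

(** At the common point both lines are tangent to the surface H = 0, whose tangent
    plane has horizontal normal (n1, n2) there. *)
Lemma coplanar_of_meet L H l l' y (n1 n2 : F) (g : {poly F}) :
    (forall m, m \in L -> restr m H = 0) -> l \in L -> l' \in L ->
    restr l H^`M(v1) = n1 *: g -> restr l H^`M(v2) = n2 *: g -> g.[y] != 0 ->
    at_height l' y = at_height l y ->
  n1 * (d1 l' - d1 l) + n2 * (d2 l' - d2 l) = 0 /\
  n1 * (e1 l' - e1 l) + n2 * (e2 l' - e2 l) = 0.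
Proof.
clearbody v0 v1 v2.
move=> HL lL l'L aE bE gy pm.
have gE m : at_height m y = at_height l y -> m \in L ->
    grad l H y v0 + d1 m * (n1 * g.[y]) + d2 m * (n2 * g.[y]) = 0.
  move=> pmm mL; rewrite -(hornerZ n1 g) -(hornerZ n2 g) -aE -bE !horner_restr.
  have := horner_deriv_restr m H y.
  by rewrite (HL m mL) deriv0 horner0 => ->; rewrite /grad pmm.
have dE : n1 * (d1 l' - d1 l) + n2 * (d2 l' - d2 l) = 0.
  apply: (mulIf gy); rewrite mul0r; apply: etrans (subrr 0).
  rewrite -{1}(gE l' pm l'L) -(gE l erefl lL); ring.
split=> //; case: pm => h1 h2.
have -> : e1 l' - e1 l = - (d1 l' - d1 l) * y.
  by apply/eqP; rewrite -subr_eq0 -(subrr (e1 l' + d1 l' * y)) {2}h1; apply/eqP; ring.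
have -> : e2 l' - e2 l = - (d2 l' - d2 l) * y.
  by apply/eqP; rewrite -subr_eq0 -(subrr (e2 l' + d2 l' * y)) {2}h2; apply/eqP; ring.
apply: etrans (mul0r (- y)); rewrite -dE; ring.
Qed.

(** If the gradient does not vanish identically on l, the lines of L through the
    rich points of l where it is nonzero lie in one plane, hence have different
    colours: there are at most k - 1 such points.  But there are more than
    q / 2 - D of them. *)
Lemma restr_partials_eq0 L H l (D k : nat) :
    (forall m, m \in L -> restr m H = 0) -> (msize H <= D.+1)%N ->
    (#|[set col m | m in L]| <= k)%N -> l \in L -> (q < 2 * #|rich L l|)%N ->
    (4 * D <= q)%N -> (2 * k + 2 * D <= q)%N ->
  restr l H^`M(v1) = 0 /\ restr l H^`M(v2) = 0.
Proof.
move=> HL sH Lk lL lrich Dq kDq.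
have := @rich_wronskian L H l _ HL lL; cbv zeta.
set a := restr l _; set b := restr l _ => wr.
have szr i : (size (restr l H^`M(i)) <= D)%N.
  apply: (leq_trans (size_line_restr _ _ _)); apply: (leq_trans (msize_mderiv _ _)).
  by case: (msize H) sH.
have sza : (size a <= D)%N := szr v1; have szb : (size b <= D)%N := szr v2.
have W0 : a * b^`() = a^`() * b.
  apply/eqP; rewrite -subr_eq0; apply/eqP/(poly_eq0_on_set wr).
  have sM (u w : {poly F}) : (size u <= D -> size w <= D -> size (u * w)%R <= 2 * D)%N.
    move=> su sw; apply: (leq_trans (size_polyMleq _ _)); lia.
  have sder (u : {poly F}) : (size u <= D -> size u^`() <= D)%N.
    by apply: leq_trans; have [->|/lt_size_deriv/ltnW//] := eqVneq u 0; rewrite deriv0.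
  apply: (@leq_trans (2 * D)); last by lia.
  apply: (leq_trans (size_polyD _ _)); rewrite geq_max size_polyN.
  by rewrite !sM ?sder.
have [/andP[/eqP-> /eqP->] //|] := boolP ((a == 0) && (b == 0)).
rewrite negb_and => ab0; exfalso.
have [n1 [n2 [g [n0 g0 sg aE bE]]]] : exists n1 n2 (g : {poly F}),
    [/\ (n1, n2) != (0, 0) :> F * F, g != 0,
     (size g <= maxn (size a) (size b))%N, a = n1 *: g & b = n2 *: g].
  have Dq' : (D <= q)%N by lia.
  exact: (wronskian_eq0_proportional charF (leq_trans sza Dq') (leq_trans szb Dq') ab0 W0).
have {}sg : (size g <= D)%N by apply: leq_trans sg _; rewrite geq_max sza szb.
pose Z := [set y | root g y]; pose Y := rich L l :\: Z.
have Zg : (#|Z| < size g)%N.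
  rewrite cardE; apply: max_poly_roots; rewrite ?enum_uniq //.
  by apply/allP => y; rewrite mem_enum inE.
pose other y := odflt l [pick m in L | (m != l) && (at_height m y == at_height l y)].
have otherP y : y \in Y -> [/\ other y \in L, other y != l & at_height (other y) y = at_height l y].
  rewrite inE => /andP[_ yR].
  have [m [_ [[mL _ ml _ _] [pm _]]]] := three_lines lL yR.
  rewrite /other; case: pickP => [m' /and3P[? ? /eqP ?] //|/(_ m)].
  by rewrite mL ml pm eqxx.
have cop y : y \in Y ->
    n1 * (d1 (other y) - d1 l) + n2 * (d2 (other y) - d2 l) = 0 /\
    n1 * (e1 (other y) - e1 l) + n2 * (e2 (other y) - e2 l) = 0.
  move=> yY; have [oL _ op] := otherP _ yY.
  apply: (@coplanar_of_meet L H l (other y) y n1 n2 g) => //.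
  by move: yY; rewrite !inE => /andP[].
have diff (x1 x2 z1 z2 w1 w2 : F) : n1 * (x1 - w1) + n2 * (x2 - w2) = 0 ->
    n1 * (z1 - w1) + n2 * (z2 - w2) = 0 -> n1 * (x1 - z1) + n2 * (x2 - z2) = 0.
  by move=> hx hz; apply: etrans (subrr 0); rewrite -{1}hx -hz; ring.
have inj : {in Y &, injective (col \o other)}.
  move=> y y' yY y'Y /= cc; have [d1E e1E] := cop _ yY; have [d2E e2E] := cop _ y'Y.
  have same : other y = other y'.
    by apply: (col_skew cc n0); [exact: diff e1E e2E|exact: diff d1E d2E].
  apply/eqP/negPn/negP => yy'; have [_ + p1] := otherP _ yY.
  have [_ _ p2] := otherP _ y'Y; rewrite -same in p2.
  by rewrite (at_height_inj yy' p1 p2) eqxx.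
have : (#|[set (col \o other) y | y in Y]| <= #|[set col m | m in L] :\ col l|)%N.
  apply/subset_leq_card/subsetP => _ /imsetP[y yY ->] /=.
  have [oL ol _] := otherP _ yY; rewrite !inE imset_f // andbT.
  apply: contra_neq ol => cc; have [d1E e1E] := cop _ yY.
  exact: col_skew cc n0 e1E d1E.
rewrite card_in_imset // => Yk.
have : (#|[set col m | m in L] :\ col l| < k)%N.
  by apply: leq_trans Lk; rewrite [X in (_ < X)%N](cardsD1 (col l)) imset_f.
have : (#|rich L l| <= #|Y| + #|Z|)%N.
  rewrite -(cardsID Z (rich L l)) addnC leq_add2l.
  by apply/subset_leq_card/subsetIr.
lia.
Qed.

(** The partial derivatives of H vanish on the same lines and have smaller degree,
    so they are zero by induction; then H is constant, and vanishes on a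
    line. *)
Lemma vanishing_on_rich_lines_eq0 L (D k : nat) :
    L != set0 -> (#|[set col m | m in L]| <= k)%N ->
    (forall l, l \in L -> (q < 2 * #|rich L l|)%N) ->
    (4 * D <= q)%N -> (2 * k + 2 * D <= q)%N ->
  forall H, (msize H <= D.+1)%N -> (forall m, m \in L -> restr m H = 0) -> H = 0.
Proof.
move=> L0 Lk Lrich Dq kDq H sH; move: {2}(msize H) (leqnn (msize H)) => s.
elim: s H sH => [|s IH] H sH sHs HL.
  by apply/eqP; rewrite -msize_poly_eq0 -leqn0.
have partial l : l \in L -> restr l H^`M(v1) = 0 /\ restr l H^`M(v2) = 0.
  by move=> lL; apply: (restr_partials_eq0 HL sH Lk lL (Lrich l lL)).
have dH i : H^`M(i) = 0.
  apply: IH.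
  - by apply: (leq_trans (msize_mderiv _ _)); apply: leq_trans sH; apply: leq_pred.
  - by apply: (leq_trans (msize_mderiv _ _)); case: (msize H) sHs.
  move=> m mL; have [h1 h2] := partial _ mL.
  have h0 : restr m H^`M(v0) = 0.
    by have := deriv_restr m H; rewrite (HL m mL) deriv0 h1 h2 !mulr0 !addr0.
  have : [|| i == v0, i == v1 | i == v2].
    by case: i => -[|[|[|//]]] hi; apply/or3P; [apply: Or31|apply: Or32|apply: Or33];
      rewrite -val_eqE /= inordK.
  by case/or3P => /eqP ->.
have sHq : (msize H <= q)%N by apply: leq_trans sH _; lia.
have HC := mderiv_eq0_const charF sHq dH.
have /set0Pn[l lL] := L0.
have := HL l lL; rewrite HC /restr /line_restr mmapC => /eqP.
by rewrite polyC_eq0 => /eqP ->.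
Qed.

Definition slice L y : {set F * F} := [set at_height l y | l in L].

(** This is at most twice the number of points covered by L, and deleting a line
    lowers it by at least the number of points of the line that are not rich.
    Both facts make it the potential for the pruning of L. *)
Definition capped_incidences L : nat := \sum_y \sum_s minn (mult L y s) 2.

Lemma mult_gt0 L y s : (0 < mult L y s)%N = (s \in slice L y).
Proof.
apply/card_gt0P/imsetP => [[l]|[l lL ->]].
  by rewrite inE => /andP[lL /eqP <-]; exists l.
by exists l; rewrite inE lL eqxx.
Qed.

Lemma capped_incidences_le L :
  (capped_incidences L <= 2 * \sum_y #|slice L y|)%N.
Proof.
rewrite big_distrr /=; apply: leq_sum => y _.
rewrite -sum1_card big_distrr /= [X in (_ <= X)%N]big_mkcond /=.
apply: leq_sum => s _; rewrite -mult_gt0; case: (mult L y s) => [|n] //=.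
by rewrite muln1 geq_minr.
Qed.

Lemma mult_setD1 L l y s : l \in L ->
  mult L y s = ((s == at_height l y) + mult (L :\ l) y s)%N.
Proof.
move=> lL; rewrite /mult (cardsD1 l) inE lL eq_sym; congr (_ + _)%N.
by apply: eq_card => m; rewrite !inE andbA.
Qed.

Lemma capped_incidences_setD1 L l : l \in L ->
  (capped_incidences (L :\ l) + #|~: rich L l| <= capped_incidences L)%N.
Proof.
move=> lL; rewrite -sum1_card big_mkcond -big_split /=; apply: leq_sum => y _.
rewrite (bigD1 (at_height l y)) //= [X in (_ <= X)%N](bigD1 (at_height l y)) //=.
rewrite !inE (mult_setD1 _ _ lL) eqxx -leqNgt; set m := mult _ _ _.
set t := (\sum_(_ | _) _)%N; set t' := (\sum_(_ | _) _)%N.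
have tt' : (t <= t')%N.
  apply: leq_sum => s _; rewrite (mult_setD1 _ _ lL); lia.
by case: leqP; lia.
Qed.

(** Take L' minimal with 2 capped_incidences L' < q |L'|.  If a line had at
    most q / 2 rich points, its removal would decrease the left side by at least q and
    the right side by q, against minimality. *)
Lemma exists_rich_sublines L : (4 * \sum_y #|slice L y| < q * #|L|)%N ->
  exists L', [/\ L' \subset L, L' != set0 &
    forall l, l \in L' -> (q < 2 * #|rich L' l|)%N].
Proof.
move=> sparse; pose P X := (2 * capped_incidences X < q * #|X|)%N.
have PL : P L by rewrite /P; have := capped_incidences_le L; lia.
have [X /minsetP[PX minX] XL] := minset_exists PL.
exists X; split=> // [|l lX].
  by apply: contraTneq PX => ->; rewrite /P cards0 muln0.
have nP : ~~ P (X :\ l).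
  apply/negP => /minX /(_ (subsetDl _ _)) /setP /(_ l).
  by rewrite !inE eqxx lX.
have cR : (#|rich X l| + #|~: rich X l| = q)%N by exact: cardsC.
move: PX nP (capped_incidences_setD1 lX) cR.
rewrite /P (cardsD1 l X) lX -leqNgt add1n mulnS.
move: (q * _)%N #|rich X l| #|~: rich X l| (capped_incidences X) => ? ? ? ?.
by move: (capped_incidences _) => ?; lia.
Qed.

Lemma card_slices L :
  #|[set p : F * (F * F) | p.2 \in slice L p.1]| = (\sum_y #|slice L y|)%N.
Proof.
rewrite -sum1_card (eq_bigl (fun p => p.2 \in slice L p.1)); last first.
  by move=> p; rewrite inE.
rewrite -(pair_big_dep xpredT (fun y s => s \in slice L y) (fun _ _ => 1%N)) /=.
by apply: eq_bigr => y _; rewrite sum1_card.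
Qed.

(** If the union has fewer than n^3 points, a nonzero polynomial of degree at most
    3 (n - 1) vanishes on it, in particular at q points of each line, hence on the
    lines. *)
Lemma union_of_lines_lower_bound L (k n : nat) :
    (#|[set col m | m in L]| <= k)%N ->
    (4 * (3 * n.-1) <= q)%N -> (2 * k + 2 * (3 * n.-1) <= q)%N ->
  (n ^ 3 <= \sum_y #|slice L y|)%N \/ (q * #|L| <= 4 * \sum_y #|slice L y|)%N.
Proof.
move=> Lk nq knq; have [|small] := leqP (n ^ 3) (\sum_y #|slice L y|); first by left.
right; rewrite leqNgt; apply/negP => /exists_rich_sublines[X [XL X0 Xrich]].
rewrite -card_slices in small.
have [H [H0 sH HS]] := exists_vanishing_mpoly (fun p => space_point p.1 p.2) small.
apply/negP: H0; rewrite negbK; apply/eqP.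
apply: (@vanishing_on_rich_lines_eq0 X (3 * n.-1) k) => //.
  by apply: leq_trans Lk; apply/subset_leq_card/imsetS.
move=> l lX; apply: (@poly_eq0_on_set _ setT) => [y _|].
  rewrite horner_restr; apply: (HS (y, at_height l y)).
  by rewrite inE; apply/imset_f/(subsetP XL).
have -> : (#|[set: F]| = q)%N by exact: cardsT.
apply: (leq_trans (size_line_restr _ _ _)); apply: leq_trans sH _.
by move: q_gt2 nq; lia.
Qed.

End LinesInSpace.

(** * Rotations of the plane *)

Lemma rotated_diffS (F : finFieldType) d (g : 'M[F]_d) (P P' : {set 'cV[F]_d * 'cV[F]_d}) :
  P \subset P' -> (#|rotated_diff g P| <= #|rotated_diff g P'|)%N.
Proof. by move=> PP'; apply/subset_leq_card/imsetS. Qed.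

Section PlaneRotations.
Variable F : finFieldType.
Local Notation V := 'cV[F]_2.
Local Notation q := #|F|.

(** (1 + y J) (1 - y J)^-1 = cayley_cos y + cayley_sin y J, as J^2 = -1. *)
Definition cayley_cos (y : F) : F := (1 - y ^+ 2) / (1 + y ^+ 2).
Definition cayley_sin (y : F) : F := 2%:R * y / (1 + y ^+ 2).

Definition cayley (y : F) : 'M[F]_2 := \matrix_(i, j)
  if i == j then cayley_cos y else if i == 0 then - cayley_sin y else cayley_sin y.

Hypothesis q3 : q = 3 %[mod 4].

Let oF : odd q.
Proof. by rewrite (divn_eq q 4) q3; rewrite oddD oddM andbF. Qed.

Lemma one_plus_sqr_neq0 (y : F) : 1 + y ^+ 2 != 0.
Proof.
apply/eqP => h; have := @sum_sqr_eq0 F 1 y q3; rewrite expr1n => /(_ h)[/eqP].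
by rewrite oner_eq0.
Qed.

Lemma mulmx_col2 (g : 'M[F]_2) (x : V) i : (g *m x) i 0 = g i 0 * x 0 0 + g i 1 * x 1 0.
Proof. by rewrite mxE big_ord_recl big_ord1; congr (_ + g i _ * x _ _); apply/val_inj. Qed.

Lemma sqnorm2 (x : V) : sqnorm x = x 0 0 ^+ 2 + x 1 0 ^+ 2.
Proof. by rewrite /sqnorm big_ord_recl big_ord1; congr (_ + x _ _ ^+ 2); apply/val_inj. Qed.

Lemma cayley_orthogonal y : cayley y \in orthogonal_group F 2.
Proof.
rewrite inE; apply/forallP => x; rewrite !sqnorm2 !mulmx_col2 !mxE /=.
apply/eqP; rewrite /cayley_cos /cayley_sin; field; exact: one_plus_sqr_neq0.
Qed.

(** The inverse is the tangent of the half angle, sin / (1 + cos). *)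
Lemma cayley_inj : injective cayley.
Proof.
move=> y z /matrixP yz; have two0 := two_neq0 oF.
have yE t : t = cayley_sin t / (1 + cayley_cos t).
  have ne : (1 + t ^+ 2 + (1 - t ^+ 2) != 0).
    by apply: contraNneq two0 => /eqP; have -> : 1 + t ^+ 2 + (1 - t ^+ 2) = 2%:R by ring.
  rewrite /cayley_cos /cayley_sin; field.
  by rewrite one_plus_sqr_neq0.
have := yz 0 0; have := yz 1 0; rewrite !mxE /= => s c.
by rewrite (yE y) s c -yE.
Qed.

(** Apply the bound for unions of lines to subsets of A and B with k = q/4
    elements, coloured by the point of A, and with 3 (n - 1) <= q/4; then
    n >= q/12 and 1728 = 12^3. *)
Lemma sum_cayley_rotated_diff (A B : {set V}) : prime q -> (6 < q)%N ->
    (q <= #|A|)%N -> (q <= #|B|)%N ->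
  (q ^ 3 <= 1728 * \sum_y #|rotated_diff (cayley y) (setX A B)|)%N.
Proof.
move=> pq q6 qA qB; pose k := (q %/ 4)%N; pose n := (q %/ 12).+1.
have kq : (k <= q)%N by rewrite /k; lia.
have [A' A'A A'k] := exists_subset_card (leq_trans kq qA).
have [B' B'B B'k] := exists_subset_card (leq_trans kq qB).
pose e1 (p : V * V) := p.1 0 0 - p.2 0 0; pose e2 (p : V * V) := p.1 1 0 - p.2 1 0.
pose d1 (p : V * V) := p.1 1 0 + p.2 1 0; pose d2 (p : V * V) := - (p.1 0 0 + p.2 0 0).
have two0 := two_neq0 oF.
have charF := prime_card_natr_neq0 pq.
have half (u v u' v' : F) : u - v = u' - v' -> u + v = u' + v' -> u = u' /\ v = v'.
  move=> hm hp; split; apply: (mulfI two0).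
    by apply: etrans (_ : (u - v) + (u + v) = _); [ring|rewrite hm hp; ring].
  by apply: etrans (_ : (u + v) - (u - v) = _); [ring|rewrite hm hp; ring].
have colP (x x' : V) : x 0 0 = x' 0 0 -> x 1 0 = x' 1 0 -> x = x'.
  move=> h0 h1; apply/colP => -[[|[|//]] i2].
    by have -> : Ordinal i2 = 0 by apply/val_inj.
  by have -> : Ordinal i2 = 1 by apply/val_inj.
have line_inj (p p' : V * V) : e1 p = e1 p' -> e2 p = e2 p' ->
    d1 p = d1 p' -> d2 p = d2 p' -> p = p'.
  case: p p' => [a b] [a' b'] /= he1 he2 hd1 /oppr_inj hd2.
  have [? ?] := half _ _ _ _ he1 hd2; have [? ?] := half _ _ _ _ he2 hd1.
  by congr (_, _); apply: colP.
have col_skew (p p' : V * V) (n1 n2 : F) : p.1 = p'.1 -> (n1, n2) != (0, 0) ->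
    n1 * (e1 p - e1 p') + n2 * (e2 p - e2 p') = 0 ->
    n1 * (d1 p - d1 p') + n2 * (d2 p - d2 p') = 0 -> p = p'.
  case: p p' => [a b] [_ b'] /= <- n0; rewrite /e1 /e2 /d1 /d2 /= => he hd.
  have N0 : n1 ^+ 2 + n2 ^+ 2 != 0.
    by apply: contraNneq n0 => /(sum_sqr_eq0 q3)[-> ->].
  congr (_, _); apply: colP; apply/(mulfI N0)/eqP; rewrite -subr_eq0; apply/eqP.
    transitivity (- n1 * 0 - n2 * 0 : F); last by rewrite !mulr0 subr0.
    by rewrite -{1}he -hd; ring.
  transitivity (- n2 * 0 + n1 * 0 : F); last by rewrite !mulr0 addr0.
  by rewrite -{1}he -hd; ring.
have slice_le y : (#|slice e1 e2 d1 d2 (setX A' B') y| <=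
    #|rotated_diff (cayley y) (setX A B)|)%N.
  apply: leq_trans (rotated_diffS _ (setXS A'A B'B)).
  apply: leq_trans (leq_imset_card (fun z : V => (z 0 0 + y * z 1 0, z 1 0 - y * z 0 0)) _).
  apply/subset_leq_card/subsetP => _ /imsetP[p pAB ->].
  apply/imsetP; exists (p.1 - cayley y *m p.2); first by apply: imset_f.
  have y0 := one_plus_sqr_neq0 y.
  have E i : (p.1 - cayley y *m p.2) i 0 = p.1 i 0 - (cayley y *m p.2) i 0.
    by rewrite !mxE.
  rewrite !E !mulmx_col2 !mxE /= /at_height /e1 /e2 /d1 /d2 /cayley_cos /cayley_sin.
  by congr (_, _); field.
have Ak : (#|[set p.1 | p in setX A' B']| <= k)%N.
  rewrite -A'k; apply/subset_leq_card/subsetP => _ /imsetP[p + ->].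
  by rewrite inE => /andP[].
have q2 : (2 < q)%N by apply: leq_trans q6.
have le_sum : (\sum_y #|slice e1 e2 d1 d2 (setX A' B') y| <=
    \sum_y #|rotated_diff (cayley y) (setX A B)|)%N by apply: leq_sum.
have nq : (4 * (3 * n.-1) <= q)%N by rewrite /n /=; lia.
have knq : (2 * k + 2 * (3 * n.-1) <= q)%N by rewrite /n /k /=; lia.
have := union_of_lines_lower_bound charF q2 line_inj col_skew Ak nq knq.
rewrite cardsX A'k B'k.
have qk : (q <= 7 * k)%N by move: q3; rewrite /k; lia.
have qn : (q <= 12 * n)%N by rewrite /n; lia.
move: (\sum_y #|slice _ _ _ _ _ _|)%N (\sum_y #|rotated_diff _ _|)%N le_sum => N N' NN'.
case=> h.
  apply: (@leq_trans (1728 * n ^ 3)); last by rewrite leq_mul2l (leq_trans h).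
  have -> : (1728 * n ^ 3 = (12 * n) ^ 3)%N by rewrite expnMn.
  by rewrite leq_exp2r.
have : (q ^ 3 <= 49 * (q * (k * k)))%N.
  rewrite mulnCA -[49%N]/(7 * 7)%N mulnACA !expnS expn0 muln1 leq_mul2l.
  by rewrite leq_mul ?orbT.
by move: (q ^ 3)%N (q * (k * k))%N h => c x h; lia.
Qed.

(** The first column (x, u) of g has u^2 = 1 - x^2, and the second one is
    det g = +- 1 times (- u, x). *)
Lemma card_orthogonal2_le : (#|orthogonal_group F 2| <= 4 * q)%N.
Proof.
have two0 := two_neq0 oF.
have orth g : g \in orthogonal_group F 2 -> [/\ g 0 0 ^+ 2 + g 1 0 ^+ 2 = 1,
    g 0 1 ^+ 2 + g 1 1 ^+ 2 = 1 & g 0 0 * g 0 1 + g 1 0 * g 1 1 = 0].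
  rewrite orthogonalP // => /eqP /matrixP gg.
  have E i j : (g^T *m g) i j = g 0 i * g 0 j + g 1 i * g 1 j.
    rewrite mxE big_ord_recl big_ord1 !mxE.
    by congr (_ + g _ _ * g _ _); apply/val_inj.
  split; [have := gg 0 0|have := gg 1 1|have := gg 0 1]; rewrite E => ->;
    by rewrite ?expr2 mxE.
rewrite -(cardsT F); apply: (leq_card_fibers (f := fun g : 'M[F]_2 => g 0 0)) => // x _.
set X := [set g in _ | _].
have [->|[g0 g0X]] := set_0Vmem X; first by rewrite cards0.
pose mk (b : bool * bool) : 'M[F]_2 :=
  let u := if b.1 then g0 1 0 else - g0 1 0 in
  let t : F := if b.2 then 1 else - 1 in
  \matrix_(i, j) if i == 0 then (if j == 0 then x else - (t * u))
                 else (if j == 0 then u else t * x).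
apply: (@leq_trans #|mk @: setT|); last first.
  by apply: leq_trans (leq_imset_card _ _) _; rewrite cardsT card_prod card_bool.
have XP g : g \in X -> g \in orthogonal_group F 2 /\ g 0 0 = x.
  by rewrite in_set => /andP[? /eqP].
apply/subset_leq_card/subsetP => g /XP[/orth[c1 c2 c12] gx].
have [/orth[c1' _ _] gx'] := XP _ g0X.
pose t := g 0 0 * g 1 1 - g 1 0 * g 0 1.
have t2 : t ^+ 2 = 1.
  transitivity ((g 0 0 ^+ 2 + g 1 0 ^+ 2) * (g 0 1 ^+ 2 + g 1 1 ^+ 2)
                - (g 0 0 * g 0 1 + g 1 0 * g 1 1) ^+ 2); first by rewrite /t; ring.
  by rewrite c1 c2 c12; ring.
have e01 : g 0 1 = - (t * g 1 0).
  transitivity ((g 0 0 ^+ 2 + g 1 0 ^+ 2) * g 0 1); first by rewrite c1 mul1r.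
  transitivity (- (t * g 1 0) + g 0 0 * (g 0 0 * g 0 1 + g 1 0 * g 1 1)).
    by rewrite /t; ring.
  by rewrite c12 mulr0 addr0.
have e11 : g 1 1 = t * g 0 0.
  transitivity ((g 0 0 ^+ 2 + g 1 0 ^+ 2) * g 1 1); first by rewrite c1 mul1r.
  transitivity (t * g 0 0 + g 1 0 * (g 0 0 * g 0 1 + g 1 0 * g 1 1)).
    by rewrite /t; ring.
  by rewrite c12 mulr0 addr0.
have /orP u2 : (g 1 0 == g0 1 0) || (g 1 0 == - g0 1 0).
  rewrite -eqf_sqr -(inj_eq (addrI (x ^+ 2))).
  by rewrite -{1}gx c1 -gx' c1'.
have /orP tb : (t == 1) || (t == - 1) by rewrite -eqf_sqr t2 expr1n.
apply/imsetP; exists (g 1 0 == g0 1 0, t == 1) => //.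
have uE : (if g 1 0 == g0 1 0 then g0 1 0 else - g0 1 0) = g 1 0.
  by case: eqP u2 => [->//|_ [//|/eqP]].
have tE : (if t == 1 then 1 else - 1) = t by case: eqP tb => [->//|_ [//|/eqP]].
have I2 (i : 'I_2) : i = 0 \/ i = 1.
  by case: i => -[|[|//]] ?; [left|right]; apply/val_inj.
apply/matrixP => i j; rewrite mxE /= uE tE.
by have [->|->] := I2 i; have [->|->] := I2 j; rewrite ?eqxx //= -?gx.
Qed.

(** Averaging: the q sets S_(g_y) have at least q^3 / 1728 elements in total and
    at most q^2 each; those with fewer than q^2 / 3456 elements contribute at most
    half of the total. *)
Lemma card_large_rotated_diff (A B : {set V}) : prime q ->
    (6 < q)%N -> (q <= #|A|)%N -> (q <= #|B|)%N ->
  (q <= 3456 * #|[set g in orthogonal_group F 2 |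
     (q ^ 2 <= 3456 * #|rotated_diff g (setX A B)|)%N]|)%N.
Proof.
move=> pq q6 qA qB; set G := [set g in _ | _].
have sumS := sum_cayley_rotated_diff pq q6 qA qB.
pose Y := [set y | (q ^ 2 <= 3456 * #|rotated_diff (cayley y) (setX A B)|)%N].
have YG : (#|Y| <= #|G|)%N.
  rewrite -(card_imset _ cayley_inj); apply/subset_leq_card/subsetP => _ /imsetP[y + ->].
  by rewrite in_set => yY; rewrite in_set cayley_orthogonal yY.
have le y : (3456 * #|rotated_diff (cayley y) (setX A B)| <=
    q ^ 2 + (y \in Y) * (3456 * q ^ 2))%N.
  have [yY|] := boolP (y \in Y); last by rewrite in_set -ltnNge addn0 => /ltnW.
  rewrite mul1n (leq_trans _ (leq_addl _ _)) // leq_mul2l /=.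
  by rewrite -(card_cV F 2) max_card.
have : (3456 * \sum_y #|rotated_diff (cayley y) (setX A B)| <=
    q * q ^ 2 + #|Y| * (3456 * q ^ 2))%N.
  rewrite big_distrr /=; apply: (@leq_trans (\sum_y (q ^ 2 + (y \in Y) * (3456 * q ^ 2)))).
    by apply: leq_sum => y _; apply: le.
  rewrite big_split sum_nat_const /= -big_distrl /= leq_add2l leq_mul2r.
  suff -> : (\sum_y (y \in Y))%N = #|Y| by rewrite leqnn orbT.
  by rewrite -sum1_card [RHS]big_mkcond; apply: eq_bigr => y _; case: (_ \in _).
have q20 : (0 < q ^ 2)%N by rewrite expn_gt0 (leq_trans _ q6).
move: sumS; rewrite expnS; move: (\sum_y _)%N => N h1 h2; clear le.
rewrite -(leq_pmul2r q20); apply: (@leq_trans (3456 * #|Y| * q ^ 2)).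
  move: h1 h2; rewrite [(#|Y| * _)%N]mulnCA -mulnA.
  by move: (q * _)%N (#|Y| * _)%N => a b; clear; lia.
by rewrite !leq_mul.
Qed.

End PlaneRotations.

(** * The exceptional set *)

(** For q <= 6 there is no exceptional g, because S_g is not empty. *)
Lemma card_exceptional_plane (F : finFieldType) (K : nat) (A B : {set 'cV[F]_2}) :
    prime #|F| -> #|F| = 3 %[mod 4] -> (3456 <= K)%N ->
    (#|F| <= #|A|)%N -> (#|F| <= #|B|)%N ->
  (4 * 3456 * #|[set g in orthogonal_group F 2 |
      (K * #|rotated_diff g (setX A B)| < #|F| ^ 2)%N]| + #|orthogonal_group F 2|
   <= 4 * 3456 * #|orthogonal_group F 2|)%N.
Proof.
move=> pF q3 K3456 qA qB; set E := [set g in _ | _]; set O := orthogonal_group F 2.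
have q0 : (0 < #|F|)%N := prime_gt0 pF.
have [q6|q6] := leqP #|F| 6.
  suff -> : E = set0 by rewrite cards0 muln0 add0n leq_pmull.
  apply/setP => g; rewrite in_set in_set0; apply/negbTE/negP => /andP[_].
  apply/negP; rewrite -leqNgt.
  have [a aA] : exists a, a \in A by apply/card_gt0P/(leq_trans q0).
  have [b bB] : exists b, b \in B by apply/card_gt0P/(leq_trans q0).
  have S1 : (0 < #|rotated_diff g (setX A B)|)%N.
    by apply/card_gt0P; exists (a - g *m b); apply/imsetP; exists (a, b); rewrite ?in_setX ?aA.
  apply: (@leq_trans (6 ^ 2)); first by rewrite leq_exp2r.
  by apply: (@leq_trans (K * 1)); [rewrite muln1 (leq_trans _ K3456)|rewrite leq_mul2l S1 orbT].
have := card_large_rotated_diff q3 pF q6 qA qB; set G := [set g in _ | _] => qG.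
have EG : (#|E| + #|G| <= #|O|)%N.
  rewrite -[X in (_ <= X)%N](cardsID E O); apply: leq_add; apply/subset_leq_card/subsetP => g.
    by rewrite in_set => gE; rewrite in_setI andbC in_set gE; case/andP: gE.
  rewrite in_set => /andP[gO gS]; rewrite in_setD gO andbT in_set negb_and -leqNgt.
  by rewrite (leq_trans gS) ?orbT // leq_mul2r K3456 orbT.
have O4 := card_orthogonal2_le q3; rewrite -/O in O4.
by move: EG O4 qG; move: #|E| #|G| #|O| #|F| => e g o f; clear; lia.
Qed.

Theorem theorem1p5 (R : realType) :
  exists C1 C2 : R, [/\ 0 < C1, 0 < C2, C2 < 1 &
    forall d : nat, (2 <= d)%N ->
    exists c : R, 0 < c /\
    forall (q : nat) (F : finFieldType), odd q -> #|F| = q ->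
    forall P : {set 'cV[F]_d * 'cV[F]_d},
    exists E : {set 'M[F]_d},
      [/\ E \subset orthogonal_group F d,
          forall g : 'M[F]_d, g \in orthogonal_group F d :\: E ->
            c * q%:R ^+ d <= #|rotated_diff g P|%:R,
          P != set0 ->
            #|E|%:R <= C1 * (q%:R ^+ d.+1 * #|orthogonal_group F d|%:R
                             / #|P|%:R) &
          d = 2%N -> prime q -> q = 3 %[mod 4] ->
          forall A B : {set 'cV[F]_d}, P = setX A B ->
            #|A| = #|B| -> (q <= #|A|)%N ->
            #|E|%:R <= (1 - C2) * #|orthogonal_group F d|%:R]].
Proof.
(* 4 * 3456 combines |O(2)| <= 4 q with the at least q / 3456 good rotations. *)
exists 1, ((4 * 3456)%:R^-1); split; rewrite ?ltr01 ?invr_gt0 ?ltr0n //.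
  by rewrite invf_lt1 ?ltr0n // ltr1n.
(* The factor 5 ^ d + 1 serves the first bound, the factor 3456 the second. *)
move=> d d2; pose K := (3456 * (5 ^ d).+1)%N.
have K0 : (0 < K)%N by rewrite muln_gt0.
exists K%:R^-1; split; first by rewrite invr_gt0 ltr0n.
move=> q F oq Fq P; subst q.
have d0 : (0 < d)%N := ltnW d2; have q1 : (1 < #|F|)%N := card_finNzRing_gt1 F.
pose E := [set g in orthogonal_group F d | (K * #|rotated_diff g P| < #|F| ^ d)%N].
exists E; split.
- by apply/subsetP => g; rewrite in_set => /andP[].
- move=> g; rewrite in_setD in_set => /andP[+ gO]; rewrite gO /= -leqNgt => large.
  by rewrite mulrC ler_pdivrMr ?ltr0n // -natrX -natrM ler_nat mulnC.
- move=> P0; rewrite mul1r ler_pdivlMr ?ltr0n ?card_gt0 // -natrX -!natrM ler_nat.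
  apply: (card_exceptional_le (C := 5 ^ d)) => //.
  + by rewrite expn_gt0.
  + by move=> m w m0; exact: card_orthogonal_sending_le.
  + by apply/subsetP => g; rewrite in_set => /andP[].
  move=> g; rewrite in_set => /andP[_ /ltnW]; apply: leq_trans.
  by rewrite leq_mul2r /K leq_pmull ?orbT.
move=> d2E; subst d => pq q3 A B PE AB qA; subst P.
have K3456 : (3456 <= K)%N by rewrite /K leq_pmulr.
have qB : (#|F| <= #|B|)%N by rewrite -AB.
have := card_exceptional_plane pq q3 K3456 qA qB; rewrite -/E => h.
rewrite -(@ler_pM2l _ (4 * 3456)%:R) ?ltr0n // mulrA mulrBr mulr1 mulfV ?pnatr_eq0 //.
rewrite mulrBl mul1r lerBrDr -!natrM -natrD ler_nat.
exact: h.
Qed.
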